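(* For each of the following sets $P$ of four generalized patterns there is an integer $k$ such that $|S_n(P)|=0$ for every $n\ge k$: (1) $P=\{1\text{-}23,2\text{-}13,3\text{-}21,r\}$ with $r\in\{12\text{-}3,1\text{-}32,13\text{-}2,3\text{-}12,31\text{-}2,21\text{-}3,2\text{-}31,23\text{-}1,32\text{-}1\}$; (2) $P=\{1\text{-}23,23\text{-}1,32\text{-}1,r\}$ with $r\in\{12\text{-}3,1\text{-}32,13\text{-}2,3\text{-}12,31\text{-}2,2\text{-}13,21\text{-}3,2\text{-}31,3\text{-}21\}$; (3) $P=\{1\text{-}23,2\text{-}13,32\text{-}1,r\}$ with $r\in\{12\text{-}3,13\text{-}2,3\text{-}12,31\text{-}2,21\text{-}3,2\text{-}31\}$; (4) $P=\{1\text{-}23,12\text{-}3,3\text{-}21,r\}$ with $r\in\{31\text{-}2,1\text{-}32,23\text{-}1,32\text{-}1\}$; (5) $P=\{1\text{-}23,21\text{-}3,3\text{-}21,r\}$ with $r\in\{1\text{-}32,13\text{-}2,3\text{-}12,31\text{-}2,23\text{-}1\}$; (6) $P=\{1\text{-}23,21\text{-}3,32\text{-}1,r\}$ with $r\in\{13\text{-}2,3\text{-}12,2\text{-}31\}$; (7) $P=\{1\text{-}23,2\text{-}31,32\text{-}1,13\text{-}2\}$.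
   Context: $S_n$ is the set of permutations $\pi=\pi_1\pi_2\cdots\pi_n$ of $\{1,\dots,n\}$. For $abc$ a permutation of $123$, the generalized pattern $a\text{-}bc$ is contained in $\pi$ if there are indices $i<j$ with $j+1\le n$ such that $\pi_i\pi_j\pi_{j+1}$ is order-isomorphic to $abc$; the generalized pattern $ab\text{-}c$ is contained in $\pi$ if there are indices $i,k$ with $i+1<k\le n$ such that $\pi_i\pi_{i+1}\pi_k$ is order-isomorphic to $abc$. (Letters not separated by a dash must occur in adjacent positions; letters separated by a dash need not be adjacent.) $\pi$ avoids a pattern if it does not contain it. For a set $P$ of generalized patterns, $S_n(P)$ is the set of $\pi\in S_n$ avoiding every pattern in $P$. *)

(* Defs.v *)
From HB Require Import structures.
From mathcomp Require Import all_boot all_fingroup.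

Set Implicit Arguments.
Unset Strict Implicit.
Unset Printing Implicit Defensive.

Variant gpattern : Type :=
| A_BC (a b c : nat) of perm_eq [:: a; b; c] [:: 1; 2; 3]
| AB_C (a b c : nat) of perm_eq [:: a; b; c] [:: 1; 2; 3].

Definition gpattern_code (p : gpattern) : bool * seq nat :=
  match p with
  | A_BC a b c _ => (false, [:: a; b; c])
  | AB_C a b c _ => (true, [:: a; b; c])
  end.

Lemma gpattern_code_inj : injective gpattern_code.
Proof.
by move=> [a b c pP|a b c pP] [a' b' c' qP|a' b' c' qP] //= [ea eb ec];
  move: pP qP; rewrite ea eb ec => pP qP; rewrite (bool_irrelevance pP qP).
Qed.

HB.instance Definition _ := Equality.copy gpattern (inj_type gpattern_code_inj).

(* The proof isT makes ill-formed letters such as [gp 1 - 2 2] a type error. *)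
Notation "[ 'gp' a - b c ]" := (@A_BC a b c isT)
  (at level 0, a at level 0, b at level 0, c at level 0,
   format "[ 'gp'  a  -  b  c ]").
Notation "[ 'gp' a b - c ]" := (@AB_C a b c isT)
  (at level 0, a at level 0, b at level 0, c at level 0,
   format "[ 'gp'  a  b  -  c ]").

Definition order_iso (s t : seq nat) : bool :=
  (size s == size t) &&
  [forall i : 'I_(size s), forall j : 'I_(size s),
    (nth 0 s i < nth 0 s j) == (nth 0 t i < nth 0 t j)].

(* Positions and values of pi : 'S_n are numbered from 0 to n - 1 instead of
   from 1 to n; this shift does not affect order isomorphism. *)
Definition contains (n : nat) (pi : 'S_n) (p : gpattern) : bool :=
  match p with
  | A_BC a b c _ =>
      [exists i : 'I_n, exists j : 'I_n, exists j1 : 'I_n,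
        [&& i < j, val j1 == j.+1 &
            order_iso [:: val (pi i); val (pi j); val (pi j1)]
                      [:: a; b; c]]]
  | AB_C a b c _ =>
      [exists i : 'I_n, exists i1 : 'I_n, exists k : 'I_n,
        [&& val i1 == i.+1, i.+1 < k &
            order_iso [:: val (pi i); val (pi i1); val (pi k)]
                      [:: a; b; c]]]
  end.

Definition avoids (n : nat) (pi : 'S_n) (p : gpattern) : bool :=
  ~~ contains pi p.

(* The set P of patterns is given by the list of its elements. *)
Definition avoiders (n : nat) (P : seq gpattern) : {set 'S_n} :=
  [set pi : 'S_n | all (avoids pi) P].

(* Main.v *)
Require Import Defs.
From mathcomp Require Import all_boot all_fingroup.

(* A prefix of an avoiding permutation, reduced to its order type, again avoids
   the patterns, so it suffices to know that no permutation of six letters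
   avoids any of the listed sets; this is a finite computation. *)

(** Unrolled substitute for [order_iso] on words of length three: its quantifiers over ordinals
    would block evaluation. Each pair is compared in both directions, as [order_iso] does. *)
Definition same_order3 (x y z a b c : nat) : bool :=
  [&& (x < y) == (a < b), (y < x) == (b < a), (x < z) == (a < c),
      (z < x) == (c < a), (y < z) == (b < c) & (z < y) == (c < b)].

Lemma order_iso3 (x y z a b c : nat) :
  same_order3 x y z a b c -> order_iso [:: x; y; z] [:: a; b; c].
Proof.
case/and5P=> xy yx xz zx /andP[yz zy]; rewrite /order_iso /=.
apply/forallP=> -[i ilt]; apply/forallP=> -[j jlt] /=.
by case: i ilt => [|[|[|]]] //; case: j jlt => [|[|[|]]] //=; rewrite !ltnn.
Qed.

(* Unlike [contains], this form reduces under [vm_compute]. *)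
Definition word_contains (s : seq nat) (p : gpattern) : bool :=
  let x := nth 0 s in
  match p with
  | A_BC a b c _ =>
      has (fun j => has (fun i => same_order3 (x i) (x j) (x j.+1) a b c)
                        (iota 0 j))
          (iota 0 (size s).-1)
  | AB_C a b c _ =>
      has (fun k => has (fun i => same_order3 (x i) (x i.+1) (x k) a b c)
                        (iota 0 k.-1))
          (iota 0 (size s))
  end.

Definition unavoidable (m : nat) (P : seq gpattern) : bool :=
  all (fun s => has (word_contains s) P) (permutations (iota 0 m)).

(** Occurrences transfer because a pattern sees only relative order and adjacency of positions, and
    a prefix of [pi] keeps both. The successor in ['S_n.+1] makes [inord] available. *)
Lemma contains_of_word (n : nat) (pi : 'S_n.+1) (s : seq nat) (p : gpattern) :
  size s <= n.+1 ->
  (forall i j, i < size s -> j < size s ->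
     (nth 0 s i < nth 0 s j) = (pi (inord i) < pi (inord j))) ->
  word_contains s p -> contains pi p.
Proof.
move=> s_le s_iso.
have same_pi i j k a b c : i < size s -> j < size s -> k < size s ->
    same_order3 (nth 0 s i) (nth 0 s j) (nth 0 s k) a b c ->
    order_iso [:: val (pi (inord i)); val (pi (inord j)); val (pi (inord k))]
              [:: a; b; c].
  by move=> ? ? ? H; apply: order_iso3; move: H; rewrite /same_order3 !s_iso.
have val_inord i : i < size s -> @inord n i = i :> nat.
  by move=> lt_i; rewrite inordK // (leq_trans lt_i).
case: p => a b c _ /= /hasP[j]; rewrite mem_iota add0n => /= lt_j.
  case/hasP=> i; rewrite mem_iota add0n => /= lt_ij iso.
  (* The search range stops at [(size s).-1] so that position [j.+1] never falls on the default
     value of [nth]. *)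
  have lt_j1 : j.+1 < size s by case: (size s) lt_j.
  have lt_j0 := ltnW lt_j1; have lt_i := ltn_trans lt_ij lt_j0.
  apply/existsP; exists (inord i); apply/existsP; exists (inord j).
  apply/existsP; exists (inord j.+1).
  by rewrite !val_inord // lt_ij eqxx same_pi.
case/hasP=> i; rewrite mem_iota add0n => /= lt_ij iso.
have lt_i1j : i.+1 < j by case: (j) lt_ij.
have lt_i1 := ltn_trans lt_i1j lt_j; have lt_i := ltnW lt_i1.
apply/existsP; exists (inord i); apply/existsP; exists (inord i.+1).
apply/existsP; exists (inord j).
by rewrite !val_inord // lt_i1j eqxx same_pi.
Qed.

(** Replace each value [f i] by its rank, the number of positions below [m] with a smaller value. *)
Lemma standardization (m : nat) (f : nat -> nat) :
  {in gtn m &, injective f} ->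
  exists2 s, perm_eq s (iota 0 m)
    & forall i j, i < m -> j < m -> (nth 0 s i < nth 0 s j) = (f i < f j).
Proof.
move=> f_inj; pose rk i := #|[set k : 'I_m | f k < f i]|.
have rk_lt i j : i < m -> f i < f j -> rk i < rk j.
  move=> lt_i lt_f; apply: proper_card; apply/properP; split.
    by apply/subsetP=> k; rewrite !inE => /ltn_trans; apply.
  (* Strictness: [i] itself is counted in the rank of [j] but not in its own. *)
  by exists (Ordinal lt_i); rewrite inE //= ltnn.
have rkE i j : i < m -> j < m -> (rk i < rk j) = (f i < f j).
  move=> lt_i lt_j; case: (ltngtP (f i) (f j)) => [/rk_lt->//|/rk_lt|eq_f].
    by move/(_ lt_j)/ltnW; rewrite leqNgt => /negbTE.
  by rewrite /rk eq_f ltnn.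
have rk_bound i : i < m -> rk i < m.
  move=> lt_i; rewrite -[X in _ < X]card_ord -cardsT; apply: proper_card.
  by apply/properP; split; [exact: subsetT | exists (Ordinal lt_i); rewrite !inE ?ltnn].
exists (mkseq rk m); last by move=> i j lt_i lt_j; rewrite !nth_mkseq ?rkE.
have rk_uniq : uniq (mkseq rk m).
  rewrite map_inj_in_uniq ?iota_uniq // => i j.
  rewrite !mem_iota !add0n => /= lt_i lt_j eq_rk; apply: f_inj => //.
  by case: (ltngtP (f i) (f j)); rewrite // -rkE // eq_rk ltnn.
have sub : {subset mkseq rk m <= iota 0 m}.
  move=> x /mapP[i]; rewrite !mem_iota !add0n => /= lt_i ->; exact: rk_bound.
(* The [m] ranks are distinct and lie below [m], so they exhaust [iota 0 m]. *)
have [|_ eq_mem] := uniq_min_size rk_uniq sub; first by rewrite size_mkseq size_iota.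
exact: uniq_perm rk_uniq (iota_uniq _ _) eq_mem.
Qed.

Lemma unavoidable_avoiders (m n : nat) (P : seq gpattern) :
  0 < m -> unavoidable m P -> m <= n -> #|avoiders n P| = 0.
Proof.
(* Positivity of [m] rules out [n = 0], where [inord] has no meaning. *)
case: n => [|n] m_gt0; first by rewrite leqNgt m_gt0.
move=> /allP unav le_mn; apply/eqP; rewrite cards_eq0; apply/eqP/setP=> pi.
rewrite !inE; apply/negbTE; rewrite -has_predC.
(* [s] is the order type of the first [m] letters of [pi]; on those positions [inord] is injective
   since [m <= n.+1]. *)
have [i j|s s_perm s_iso] := @standardization m (fun i => pi (inord i)).
  rewrite !inE => lt_i lt_j /val_inj/perm_inj/(congr1 val) /=.
  by rewrite !inordK // (leq_trans _ le_mn).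
have s_size : size s = m by rewrite (perm_size s_perm) size_iota.
have /unav/hasP[p pP s_p] : s \in permutations (iota 0 m).
  by rewrite mem_permutations.
apply/hasP; exists p => //; rewrite /= negbK.
by apply: contains_of_word s_p; rewrite s_size.
Qed.

(** Cases (1) to (6) fix three patterns and vary the last; [rcons P r] is convertible to the
    displayed list of four. The single length 6 serves every [r], so each case becomes one
    evaluation over the 720 words. *)
Lemma unavoidable_family (P R : seq gpattern) :
  all (fun r => unavoidable 6 (rcons P r)) R ->
  forall r, r \in R -> exists k, forall n, k <= n ->
    #|avoiders n (rcons P r)| = 0.
Proof. by move=> /allP H r /H un; exists 6 => n; apply: unavoidable_avoiders. Qed.

Theorem mainTheorem5 :
  (forall r : gpattern,
     r \in [:: [gp 1 2 - 3]; [gp 1 - 3 2]; [gp 1 3 - 2]; [gp 3 - 1 2];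
        [gp 3 1 - 2]; [gp 2 1 - 3]; [gp 2 - 3 1]; [gp 2 3 - 1];
        [gp 3 2 - 1]] ->
     exists k : nat, forall n : nat, k <= n ->
       #|avoiders n [:: [gp 1 - 2 3]; [gp 2 - 1 3]; [gp 3 - 2 1]; r]| = 0) /\
  (forall r : gpattern,
     r \in [:: [gp 1 2 - 3]; [gp 1 - 3 2]; [gp 1 3 - 2]; [gp 3 - 1 2];
        [gp 3 1 - 2]; [gp 2 - 1 3]; [gp 2 1 - 3]; [gp 2 - 3 1];
        [gp 3 - 2 1]] ->
     exists k : nat, forall n : nat, k <= n ->
       #|avoiders n [:: [gp 1 - 2 3]; [gp 2 3 - 1]; [gp 3 2 - 1]; r]| = 0) /\
  (forall r : gpattern,
     r \in [:: [gp 1 2 - 3]; [gp 1 3 - 2]; [gp 3 - 1 2]; [gp 3 1 - 2];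
        [gp 2 1 - 3]; [gp 2 - 3 1]] ->
     exists k : nat, forall n : nat, k <= n ->
       #|avoiders n [:: [gp 1 - 2 3]; [gp 2 - 1 3]; [gp 3 2 - 1]; r]| = 0) /\
  (forall r : gpattern,
     r \in [:: [gp 3 1 - 2]; [gp 1 - 3 2]; [gp 2 3 - 1]; [gp 3 2 - 1]] ->
     exists k : nat, forall n : nat, k <= n ->
       #|avoiders n [:: [gp 1 - 2 3]; [gp 1 2 - 3]; [gp 3 - 2 1]; r]| = 0) /\
  (forall r : gpattern,
     r \in [:: [gp 1 - 3 2]; [gp 1 3 - 2]; [gp 3 - 1 2]; [gp 3 1 - 2];
        [gp 2 3 - 1]] ->
     exists k : nat, forall n : nat, k <= n ->
       #|avoiders n [:: [gp 1 - 2 3]; [gp 2 1 - 3]; [gp 3 - 2 1]; r]| = 0) /\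
  (forall r : gpattern,
     r \in [:: [gp 1 3 - 2]; [gp 3 - 1 2]; [gp 2 - 3 1]] ->
     exists k : nat, forall n : nat, k <= n ->
       #|avoiders n [:: [gp 1 - 2 3]; [gp 2 1 - 3]; [gp 3 2 - 1]; r]| = 0) /\
  (exists k : nat, forall n : nat, k <= n ->
     #|avoiders n [:: [gp 1 - 2 3]; [gp 2 - 3 1]; [gp 3 2 - 1]; [gp 1 3 - 2]]| = 0).
Proof.
split; first by apply: (@unavoidable_family [:: [gp 1 - 2 3]; [gp 2 - 1 3]; [gp 3 - 2 1]]); vm_compute.
split; first by apply: (@unavoidable_family [:: [gp 1 - 2 3]; [gp 2 3 - 1]; [gp 3 2 - 1]]); vm_compute.
split; first by apply: (@unavoidable_family [:: [gp 1 - 2 3]; [gp 2 - 1 3]; [gp 3 2 - 1]]); vm_compute.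
split; first by apply: (@unavoidable_family [:: [gp 1 - 2 3]; [gp 1 2 - 3]; [gp 3 - 2 1]]); vm_compute.
split; first by apply: (@unavoidable_family [:: [gp 1 - 2 3]; [gp 2 1 - 3]; [gp 3 - 2 1]]); vm_compute.
split; first by apply: (@unavoidable_family [:: [gp 1 - 2 3]; [gp 2 1 - 3]; [gp 3 2 - 1]]); vm_compute.
by exists 6 => n; apply: unavoidable_avoiders; last by vm_compute.
Qed.
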